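(* Let $k,d$ range over nonnegative integers. Every $2$-prime binary string is either of the form $10^k10^d1$ with $k<d$, or of the form $0^{d+1}10^d1$.
   Context: For a finite binary string $s$ (indexed from $0$), let $n(s)=\{i: s_i=1\}\subseteq\mathbb{N}$. For a binary string $S$, let $\mathfrak{S}=\{n(s): s \text{ a finite contiguous substring of } S\}$; a set $B\subseteq\mathbb{N}$ is shattered if $\{c\cap B: c\in\mathfrak{S}\}$ is the power set of $B$, and $VCdim(S)$ is the largest size of a shattered set. For $d\in\mathbb{N}$, a binary string $S$ is $d$-prime if $VCdim(S)=d$ and every proper (contiguous) substring $S'$ of $S$ has $VCdim(S')<d$. $0^k$ denotes a block of $k$ zeros. *)

(* Defs.v *)
From mathcomp Require Import all_boot all_order all_algebra.
From mathcomp Require Import all_classical.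

Set Implicit Arguments.
Unset Strict Implicit.
Unset Printing Implicit Defensive.

Local Open Scope classical_set_scope.
Local Open Scope card_scope.

(* Binary strings, finite or infinite; [true] is the letter 1.  The letter
   [x n] of [LeftInf x] is the one at position [-(n+1)], so [LeftInf x] reads
   ... x 2, x 1, x 0. *)
Inductive bstring : Type :=
| Fin of seq bool
| RightInf of (nat -> bool)
| LeftInf of (nat -> bool)
| BiInf of (int -> bool).

(* The letter at a position; [None] off the string. *)
Definition letter (S : bstring) (i : int) : option bool :=
  match S with
  | Fin s => if i is Posz n then onth s n else None
  | RightInf x => if i is Posz n then Some (x n) else None
  | LeftInf x => if i is Negz n then Some (x n) else None
  | BiInf x => Some (x i)
  end.

(* [T] is the contiguous block of [S] cut out at offset [m]. *)
Definition occurs_at (T S : bstring) (m : int) : Prop :=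
  forall (i : int) (b : bool),
    letter T i = Some b -> letter S (m + i)%R = Some b.

Definition substring (T S : bstring) : Prop := exists m : int, occurs_at T S m.

(* An occurrence of [T] in [S] that omits at least one position of [S].  For
   finite [S] this amounts to [substring T S] and [T <> S]. *)
Definition proper_substring (T S : bstring) : Prop :=
  exists m : int, occurs_at T S m /\
    exists i : int, letter S (m + i)%R <> None /\ letter T i = None.

Definition ones (s : seq bool) : set nat := [set i | nth false s i = true].

Definition concepts (S : bstring) : set (set nat) :=
  [set ones s | s in [set s : seq bool | substring (Fin s) S]].

Definition shattered (S : bstring) (B : set nat) : Prop :=
  [set c `&` B | c in concepts S] = [set A : set nat | A `<=` B].

(* The VC dimension is a relation, since it may fail to be finite. *)
Definition is_VCdim (S : bstring) (d : nat) : Prop :=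
  (exists B : set nat, shattered S B /\ B #= `I_d) /\
  (forall B : set nat, shattered S B -> B #<= `I_d).

Definition VCdim_lt (S : bstring) (d : nat) : Prop :=
  exists2 e : nat, (e < d)%N & is_VCdim S e.

Definition prime_string (d : nat) (S : bstring) : Prop :=
  is_VCdim S d /\
  forall T : bstring, proper_substring T S -> VCdim_lt T d.

(* Main.v *)
Require Import Defs.
From mathcomp Require Import all_boot all_order all_algebra.
From mathcomp Require Import all_classical.
From mathcomp Require Import zify.

(** Truncating a substring yields the trace [{a}] for free, so a string has VC
    dimension at least 2 iff for some distance [g > 0] it has two ones at
    distance [g] and also a zero followed by a one at distance [g].  Both
    families of the theorem have this property, so a 2-prime string containing
    a member of either family is equal to it.  If a string contains none, then
    consecutive gaps between ones never increase (first family), and never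
    decrease (second family), so they are all equal to some [h]; moreover fewer
    than [h] zeros precede the first one (second family).  The ones are then
    exactly the positions [x, x + h, x + 2h, ...] up to the last one, with
    [x < h], so a position at distance [g] before a one carries a one whenever
    [g] is the distance of two ones, and the VC dimension is at most 1. *)

Set Implicit Arguments.
Unset Strict Implicit.
Unset Printing Implicit Defensive.

(** * Ones of a word that avoids both families *)

Section Gaps.

Variables (f : nat -> bool) (N : nat).

Definition consecutive_ones (x y : nat) : Prop :=
  [/\ x < y < N, f x, f y & forall i, x < i < y -> ~~ f i].

(* Absence of the first family of patterns. *)
Hypothesis gaps_nonincreasing : forall x y z,
  consecutive_ones x y -> consecutive_ones y z -> z - y <= y - x.

(* Absence of the second family of patterns. *)
Hypothesis one_before_gap : forall y z,
  consecutive_ones y z -> z - y <= y ->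
  exists2 i, y - (z - y) <= i < y & f i.

Lemma next_one y z : y < z < N -> f y -> f z ->
  exists2 z', consecutive_ones y z' & z' <= z.
Proof.
move=> yz fy fz.
have ex : exists i, f i && (y < i) by exists z; rewrite fz; case/andP: yz.
case: (ex_minnP ex) => m /andP[fm ym] minm.
have mz : m <= z by apply: minm; rewrite fz; case/andP: yz.
exists m => //; split => //; first lia.
move=> i /andP[yi im]; apply/negP => fi.
by have := minm i; rewrite fi yi => /(_ isT); lia.
Qed.

(** A smaller second gap would put the [z - y] positions before [y] strictly between [x] and [y],
    where there are no ones, against [one_before_gap]. *)
Lemma consecutive_gaps_eq x y z :
  consecutive_ones x y -> consecutive_ones y z -> z - y = y - x.
Proof.
move=> xy yz; have le := gaps_nonincreasing xy yz.
apply/eqP; rewrite eqn_leq le /= leqNgt; apply/negP => lt.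
have /= [//|i i1 fi] := one_before_gap yz; first by case: xy; lia.
case: xy => x1 _ _ /(_ i); rewrite fi => zero.
have : x < i < y by lia.
by move/zero.
Qed.

(** Take for [x] the first one and for [h] its distance to the next; equality of consecutive gaps
    propagates [h] as long as a later one exists. *)
Lemma ones_periodic p : p < N -> f p ->
  (exists2 p', p < p' < N & f p') ->
  exists x h, [/\ 0 < h, x < h,
    forall z, z < N -> f z -> exists j, z = x + j * h &
    forall z j, z < N -> f z -> x + j * h <= z -> f (x + j * h)].
Proof.
move=> pN fp [p' pp' fp'].
have ex : exists i, f i by exists p.
case: (ex_minnP ex) => x fx minx.
have xp := minx _ fp.
have [|y xy _] := @next_one x p' _ fx fp'; first lia.
have [x1 _ fy _] := xy.
have [h h0 yE] : exists2 h, 0 < h & y = x + h by exists (y - x); lia.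
rewrite {y}yE in xy x1 fy.
have gap j : forall z, z < N -> f z -> x + j * h < z ->
    consecutive_ones (x + j * h) (x + j.+1 * h).
  elim: j => [|j IH] z zN fz lt.
    by rewrite mul0n addn0 mul1n.
  have g := IH z zN fz ltac:(lia).
  have [_ _ f1 _] := g.
  have [|z' g' _] := @next_one _ z _ f1 fz; first lia.
  have e := consecutive_gaps_eq g g'.
  have [/andP[z'1 _] _ _ _] := g'.
  by rewrite (_ : x + j.+2 * h = z') //; move: e z'1; rewrite !mulSn; lia.
exists x, h; split => //.
(* If [h <= x], there would be a one before [x], the first one. *)
- rewrite ltnNge; apply/negP => hx.
  have [|i i1 fi] := one_before_gap xy; first lia.
  by have := minx _ fi; lia.
- move=> z zN fz; have xz := minx _ fz.
  have := divn_eq (z - x) h; have := ltn_pmod (z - x) h0.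
  move: (_ %/ h) (_ %% h) => j r rh e; exists j.
  apply/eqP; rewrite eqn_leq andbC; apply/andP; split; first lia.
  (* Since [r < h], such a [z] would lie strictly inside a gap. *)
  rewrite leqNgt; apply/negP => lt.
  have [_ _ _ /(_ z)] := gap _ _ zN fz lt; rewrite fz => zero.
  by have : false by apply: zero; rewrite mulSn; lia.
- move=> z j zN fz; rewrite leq_eqVlt => /orP[/eqP->//|lt].
  by case: (gap _ _ zN fz lt).
Qed.

Lemma one_at_same_distance p q g : 0 < g -> p + g < N -> q + g < N ->
  f p -> f (p + g) -> f (q + g) -> f q.
Proof.
move=> g0 pN qN fp fpg fqg.
have [||x [h [h0 xh mult ones_x]]] := @ones_periodic p _ fp; first lia.
  by exists (p + g) => //; lia.
have [i ei] := mult p ltac:(lia) fp.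
have [j ej] := mult _ pN fpg.
have [l el] := mult _ qN fqg.
have ij : i <= j by nia.
have eg : g = (j - i) * h by rewrite mulnBl; lia.
(* Here [x < h] matters: [l < j - i] would give [q + g = x + l * h < (l + 1) * h <= g]. *)
have jl : j - i <= l by rewrite leqNgt; apply/negP => lt; nia.
have eq : q = x + (l - (j - i)) * h by rewrite mulnBl; nia.
by rewrite eq; apply: ones_x qN fqg _; lia.
Qed.

End Gaps.

Local Open Scope classical_set_scope.
Local Open Scope card_scope.

(** * Letters and substrings *)

Lemma letter_Fin s i b :
  letter (Fin s) i = Some b <->
  exists n : nat, [/\ i = Posz n, n < size s & nth false s n = b].
Proof.
split=> [|[n [-> ns <-]]] /=.
- case: i => // n /= sn; exists n; split=> //; last exact: onth_nth sn.
  by have := onthTE s n; rewrite sn.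
- by rewrite onthE (nth_map false).
Qed.

Lemma letter_convex S (i j k : int) : (i <= k <= j)%R ->
  letter S i <> None -> letter S j <> None -> letter S k <> None.
Proof.
case: S => [s|x|x|x] //=.
- case: j => j; case: k => k; case: i => i //=; try lia.
  move=> ikj _ sj sk; apply: sj; apply: onth_default.
  by have := onthNE s k; rewrite sk /=; lia.
- by case: k => k; case: i => i //=; lia.
- by case: k => k; case: j => j //=; case: i => i; lia.
Qed.

Lemma substring_drop p s : substring (Fin (drop p s)) (Fin s).
Proof.
exists p => i b /letter_Fin[n [-> ns <-]]; apply/letter_Fin.
rewrite size_drop in ns; exists (p + n)%N.
by rewrite nth_drop; split=> //; lia.
Qed.

Lemma substring_take n s : substring (Fin (take n s)) (Fin s).
Proof.
exists 0%R => i b /letter_Fin[k [-> ks <-]]; apply/letter_Fin.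
rewrite size_take_min in ks; exists k.
by rewrite nth_take; [split; lia|lia].
Qed.

Lemma substring_trans S T U : substring S T -> substring T U -> substring S U.
Proof.
move=> [m mST] [n nTU]; exists (n + m)%R => i b /mST/nTU.
by rewrite GRing.addrA.
Qed.

(** * Shattered pairs and primality *)

Lemma card_pair (a b : nat) : a != b -> [set a; b] #= `I_2.
Proof.
move=> ab; apply/eq_cardSP; exists a; first by left.
suff -> : [set a; b] `\ a = [set b] by exact: card_set1.
apply/seteqP; split=> x /=; first by case=> -[].
by move=> ->; split; [right|move=> ba; rewrite ba eqxx in ab].
Qed.

Lemma card_pairP (B : set nat) : B #= `I_2 -> exists a b, [/\ a < b, B a & B b].
Proof.
case/eq_cardSP => a Ba /eq_cardSP[b [Bb /= ba] _].
by case: (ltngtP a b) => ab; [exists a, b|exists b, a|case: ba].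
Qed.

(** The trace [B] supplies [p], and the trace [[set b]] supplies [q]. *)
Lemma shattered_distances S B (a b : nat) : shattered S B -> a < b -> B a -> B b ->
  exists p q : int, let g := Posz (b - a) in
  [/\ letter S p = Some true, letter S (p + g)%R = Some true,
     letter S q = Some false & letter S (q + g)%R = Some true].
Proof.
move=> shB ab Ba Bb.
have trace A : A `<=` B -> exists2 s, substring (Fin s) S & ones s `&` B = A.
  rewrite -[_ `<=` _]/([set A | A `<=` B] A) -shB => -[_ [s sS <-] <-].
  by exists s.
have size_one s i : nth false s i = true -> i < size s.
  by move=> si; rewrite ltnNge; apply/negP => /(nth_default false); rewrite si.
have [s [m mS] sB] := trace B (@subset_refl _ B).
have [t [n nS] tb] := trace [set b] ltac:(by move=> _ ->).
have [sa _] : (ones s `&` B) a by rewrite sB.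
have [sb _] : (ones s `&` B) b by rewrite sB.
have [/= tb1 _] : (ones t `&` B) b by rewrite tb.
have ta : nth false t a = false.
  apply/negP => ta; have : (ones t `&` B) a by [].
  by rewrite tb /= => ab'; rewrite ab' ltnn in ab.
exists (m + a)%R, (n + a)%R.
rewrite -!GRing.addrA -!PoszD subnKC; last exact: ltnW.
(* As [a < b < size t], the zero of [t] at [a] is an actual letter, not the default of [nth]. *)
have := size_one _ _ sa; have := size_one _ _ sb; have := size_one _ _ tb1.
by split; [apply: mS|apply: mS|apply: nS|apply: nS]; apply/letter_Fin;
  [exists a|exists b|exists a|exists b]; split=> //; lia.
Qed.

(** The suffix at [p] traces both points, the suffix at [q] only [g], the single letter at [p] only
    [0], and the empty word nothing. *)
Lemma shattered_pair w p q g : 0 < g ->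
  nth false w p -> nth false w (p + g) ->
  ~~ nth false w q -> nth false w (q + g) -> shattered (Fin w) [set 0; g].
Proof.
move=> g0 wp wpg wq wqg; apply/seteqP; split=> A /=.
  by case=> c _ <- x [].
move=> sA.
suff [s sw sA'] : exists2 s, substring (Fin s) (Fin w) &
    (nth false s 0 <-> A 0) /\ (nth false s g <-> A g).
  exists (ones s); first by exists s.
  apply/seteqP; split=> x /=.
    by move=> [/[swap] -[] ->]; rewrite /ones /=; tauto.
  by move=> Ax; split; [|exact: sA]; move: Ax (sA _ Ax) => /[swap] -[] ->; tauto.
have [A0|A0] := pselect (A 0); have [Ag|Ag] := pselect (A g).
- exists (drop p w); first exact: substring_drop.
  by rewrite !nth_drop addn0 wp wpg.
- exists (take 1 (drop p w)).
    exact: substring_trans (substring_take _ _) (substring_drop _ _).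
  rewrite nth_take // nth_drop addn0 wp nth_default //.
  by rewrite size_take_min; lia.
- exists (drop q w); first exact: substring_drop.
  by rewrite !nth_drop addn0 (negbTE wq) wqg.
- exists [::]; last by rewrite !nth_nil.
  by exists 0%R => i b /letter_Fin[n []].
Qed.

Lemma shattered_pair_VCdim_nlt2 T (a b : nat) : a != b ->
  shattered T [set a; b] -> ~ VCdim_lt T 2.
Proof.
move=> ab sh [e e2 [_ /(_ _ sh)]].
by rewrite (card_le_eql (card_pair ab)) card_le_II leqNgt e2.
Qed.

(** An occurrence of [w] missing a letter of [S] would be proper, so primality would push the
    dimension of [w] below 2. *)
Lemma prime_string_eq_substring S w : w != [::] -> prime_string 2 S ->
  ~ VCdim_lt (Fin w) 2 -> substring (Fin w) S -> S = Fin w.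
Proof.
move=> w0 [_ pS] nw [m mS].
have w_size : 0 < size w by case: w w0 {nw mS}.
have covered i : letter S i <> None -> exists2 n : nat, n < size w & (i = m + n)%R.
  move=> Si; case E : (letter (Fin w) (i - m)%R) => [b|].
    by move/letter_Fin: E => [n [e n1 _]]; exists n => //; lia.
  case: nw; apply: pS; exists m; split=> //; exists (i - m)%R.
  by rewrite GRing.addrC GRing.subrK.
have Sm n : n < size w -> letter S (m + n)%R = Some (nth false w n).
  by move=> nw'; apply: mS; apply/letter_Fin; exists n.
case: S {pS} mS covered Sm => [s|x|x|x] mS covered Sm.
(* The first letter of [w] lies in [s], so [m >= 0]; position 0 is covered, so [m <= 0]. *)
- have Sm0 := Sm 0 w_size.
  move/letter_Fin: (Sm0) => [k [e ks _]].
  have [|n n1 e1] := covered 0%R.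
    by rewrite (proj2 (letter_Fin s 0 (nth false s 0))) //; exists 0; split=> //; lia.
  have m0 : m = 0%R by lia.
  congr Fin; apply: eq_from_onth => i; rewrite m0 in Sm covered.
  case: (ltnP i (size w)) => iw.
    have := Sm i iw; rewrite GRing.add0r /= => ->.
    by rewrite onthE (nth_map false).
  rewrite (onth_default iw); case E : (onth s i) => [b|//].
  have [|j j1] := covered i; first by rewrite /= E.
  by lia.
(* An infinite string has an uncovered letter next to the occurrence: after its end here, before its
   start in the other two cases. *)
- have := Sm 0 w_size; case: m {mS Sm} covered => m covered; last first.
    by rewrite GRing.addr0.
  by have [//|n n1 e] := covered (Posz (m + size w)); lia.
- have := Sm 0 w_size; case: m {mS Sm} covered => m covered; first by rewrite GRing.addr0.
  by have [//|n n1 e] := covered (Negz m.+1); lia.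
- by have [//|n n1 e] := covered (m - 1)%R; lia.
Qed.

(** * The two families *)

Lemma nth_seq1 n : nth false [:: true] n = (n == 0).
Proof. by case: n => [|[]]. Qed.

Lemma nth_three_ones k d n :
  nth false ([:: true] ++ nseq k false ++ [:: true] ++ nseq d false ++ [:: true]) n =
  [|| n == 0, n == k.+1 | n == k + d + 2].
Proof.
rewrite !nth_cat !nth_seq1 !nth_nseq /= !size_nseq !if_same.
by repeat case: ifP => //; lia.
Qed.

Lemma size_three_ones k d :
  size ([:: true] ++ nseq k false ++ [:: true] ++ nseq d false ++ [:: true]) =
  k + d + 3.
Proof. by rewrite !size_cat !size_nseq /=; lia. Qed.

Lemma size_two_ones e d :
  size (nseq e false ++ [:: true] ++ nseq d false ++ [:: true]) = e + d + 2.
Proof. by rewrite !size_cat !size_nseq /=; lia. Qed.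

Lemma nth_two_ones e d n :
  nth false (nseq e false ++ [:: true] ++ nseq d false ++ [:: true]) n =
  (n == e) || (n == e + d.+1).
Proof.
rewrite !nth_cat !nth_seq1 !nth_nseq /= !size_nseq !if_same.
by repeat case: ifP => //; lia.
Qed.

Lemma three_ones_VCdim_nlt2 k d : k < d ->
  ~ VCdim_lt
      (Fin ([:: true] ++ nseq k false ++ [:: true] ++ nseq d false ++ [:: true])) 2.
Proof.
move=> kd; apply: (@shattered_pair_VCdim_nlt2 _ 0 k.+1) => //.
(* The distance is [k + 1]: it separates the first two ones, and also the last one from position
   [d + 1], a zero because [k < d]. *)
by apply: (@shattered_pair _ 0 d.+1) => //; rewrite nth_three_ones; lia.
Qed.

Lemma two_ones_VCdim_nlt2 d :
  ~ VCdim_lt (Fin (nseq d.+1 false ++ [:: true] ++ nseq d false ++ [:: true])) 2.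
Proof.
apply: (@shattered_pair_VCdim_nlt2 _ 0 d.+1) => //.
by apply: (@shattered_pair _ d.+1 0) => //; rewrite nth_two_ones; lia.
Qed.

(** * Classification of 2-prime strings *)

Theorem theorem7 (S : bstring) (hS : prime_string 2 S) :
  (exists k d : nat, (k < d)%N /\
     S = Fin ([:: true] ++ nseq k false ++ [:: true] ++ nseq d false ++ [:: true]))
  \/
  (exists d : nat,
     S = Fin (nseq d.+1 false ++ [:: true] ++ nseq d false ++ [:: true])).
Proof.
have [[[B [shB cB]] _] _] := hS.
have [a [b [ab Ba Bb]]] := card_pairP cB.
have [p [q /= [Sp Spg Sq Sqg]]] := shattered_distances shB ab Ba Bb.
have g0 : 0 < b - a by lia.
move: (b - a)%N g0 Spg Sqg => g g0 Spg Sqg {a b B shB cB ab Ba Bb}.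
(* With [lo] the smaller of [p] and [q], all four letters have natural offsets. *)
have [lo [P [Q [Pp Qq PQ]]]] : exists (lo : int) (P Q : nat),
    [/\ p = (lo + P)%R, q = (lo + Q)%R & P = 0 \/ Q = 0].
  have [pq|pq] : (p <= q)%R \/ (q <= p)%R by lia.
    by exists p, 0%N, (absz (q - p)%R); split; [lia|lia|left].
  by exists q, (absz (p - q)%R), 0%N; split; [lia|lia|right].
pose N := (maxn P Q + g).+1.
pose f n := letter S (lo + Posz n)%R == Some true.
(* Both ends of the window carry letters, hence so does every position between; there [f] never
   turns a missing letter into a zero. *)
have window n : n < N -> letter S (lo + Posz n)%R = Some (f n).
  move=> nN; have : letter S (lo + Posz n)%R <> None.
    have [lo_letter hi_letter] : letter S lo <> None /\
        letter S (lo + Posz (maxn P Q + g))%R <> None.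
      case: PQ => PQ0; rewrite PQ0 ?max0n ?maxn0 PoszD GRing.addrA.
      - by rewrite -Qq Sqg; split=> //; rewrite Pp PQ0 GRing.addr0 in Sp; rewrite Sp.
      - by rewrite -Pp Spg; split=> //; rewrite Qq PQ0 GRing.addr0 in Sq; rewrite Sq.
    by apply: letter_convex lo_letter hi_letter; rewrite /N in nN; lia.
  by rewrite /f; case: (letter S _) => [[]|].
have eq_window (w : seq bool) x : x + size w <= N -> w != [::] -> ~ VCdim_lt (Fin w) 2 ->
    (forall n, n < size w -> nth false w n = f (x + n)) -> S = Fin w.
  move=> xN w0 nw wf; apply: prime_string_eq_substring => //.
  exists (lo + Posz x)%R => i _ /letter_Fin[n [-> ns <-]].
  rewrite -GRing.addrA -PoszD wf // window //.
  by apply: leq_trans xN; rewrite ltn_add2l.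
apply: contrapT => npat.
have fQ : ~~ f Q by rewrite /f -Qq Sq.
suff : f Q by rewrite (negbTE fQ).
apply: (@one_at_same_distance f N _ _ P Q g) => //; rewrite ?/N.
- move=> x y z [xy fx fy zxy] [yz _ fz zyz].
  rewrite leqNgt; apply/negP => lt; apply: npat; left.
  (* A growing gap makes the block from [x] to [z] a member of the first family. *)
  exists (y - x).-1, (z - y).-1; split; first lia.
  apply: (eq_window _ x) => //; first by rewrite size_three_ones; lia.
    by apply: three_ones_VCdim_nlt2; lia.
  move=> n; rewrite nth_three_ones size_three_ones => ns.
  case: (eqVneq n 0) => [->|n0]; first by rewrite addn0 fx.
  case: (eqVneq n (y - x).-1.+1) => [->|n1]; first by rewrite (_ : x + _ = y) ?fy //; lia.
  case: (eqVneq n _) => [->|n2]; first by rewrite (_ : x + _ = z) ?fz //; lia.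
  apply/esym/negbTE; case: (ltnP (x + n) y) => xn; [apply: zxy|apply: zyz]; lia.
- move=> y z [yz fy fz zyz] le.
  apply: contrapT => none; apply: npat; right.
  (* Without ones in the [z - y] positions before [y], the block from [y - (z - y)] to [z] is in the
     second family; [le] keeps the subtraction exact. *)
  exists (z - y).-1.
  apply: (eq_window _ (y - (z - y))) => //.
  + by rewrite (size_two_ones (z - y).-1.+1); lia.
  + exact: two_ones_VCdim_nlt2.
  move=> n; rewrite (nth_two_ones (z - y).-1.+1) (size_two_ones (z - y).-1.+1) => ns.
  case: (eqVneq n (z - y).-1.+1) => [->|n1]; first by rewrite (_ : y - (z - y) + _ = y) ?fy //; lia.
  case: (eqVneq n _) => [->|n2]; first by rewrite (_ : y - (z - y) + _ = z) ?fz //; lia.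
  apply/esym/negbTE; case: (ltnP (y - (z - y) + n) y) => xn; last by apply: zyz; lia.
  by apply/negP => fn; apply: none; exists (y - (z - y) + n) => //; lia.
- by rewrite ltnS leq_add2r leq_maxl.
- by rewrite ltnS leq_add2r leq_maxr.
- by rewrite /f -Pp Sp.
- by rewrite /f PoszD GRing.addrA -Pp Spg.
- by rewrite /f PoszD GRing.addrA -Qq Sqg.
Qed.
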